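(* Let $\eta\in\{0,1\}^{\mathbb{N}^*}$ be a Sturmian sequence and let $u\in\{-1,0,1\}^{\mathbb{N}^*}$ be generic for the Bernoulli measure $B(1/4,1/2,1/4)$. Let $\delta\in[0,1]$ be the unique number such that, for all $n$ large enough, $$\delta n-3<\#1(B_n)<\delta n+3\quad\text{for every block } B_n\in\{0,1\}^n \text{ appearing in }\eta .$$ Then the sequence $z:=\eta\cdot u$ satisfies condition (Ch), $h_{top}(z^2)=\delta$ and $h_{top}(z)=\delta\log 3$. Moreover, for each $\delta\in[0,1]$, the pair $(\delta,\delta\log 3)$ is realized as $(h_{top}(z^2),h_{top}(z))$ for some sequence $z\in\{-1,0,1\}^{\mathbb{N}^*}$ satisfying (Ch).
   Context: $\mathbb{N}^*=\{1,2,3,\dots\}$; sums $\sum_{n\le N}$ are over $1\le n\le N$; logarithms are to base $2$. Products and squares of sequences are coordinatewise: $(\eta\cdot u)(n)=\eta(n)u(n)$, $z^2(n)=z(n)^2$. For a finite alphabet $A$, a block is an element of $A^n$; it appears in $w\in A^{\mathbb{N}^*}$ if it equals $w(t)w(t+1)\dots w(t+n-1)$ for some $t$. $p_n(w)$ is the number of distinct blocks of length $n$ appearing in $w$, and $h_{top}(w):=\lim_{n\to\infty}\frac1n\log p_n(w)$. A sequence $w\in\{0,1\}^{\mathbb{N}^*}$ is Sturmian if $p_n(w)=n+1$ for all $n\in\mathbb{N}^*$. $\#1(B_n)$ is the number of coordinates of $B_n$ equal to $1$; for a Sturmian $\eta$ the number $\delta$ in the claim exists and is unique. $B(1/4,1/2,1/4)$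 is the product measure on $\{-1,0,1\}^{\mathbb{N}^*}$ giving probabilities $1/4,1/2,1/4$ to the symbols $-1,0,1$ respectively. A point $u$ is generic for a measure $\nu$ if $\frac1N\sum_{n\le N}\delta_{S^nu}\to\nu$ weakly, where $S$ is the left shift. Condition (Ch) for $z\in\{-1,0,1\}^{\mathbb{N}^*}$: for each choice of integers $1\le a_1<\dots<a_r$, $r\ge 0$, and exponents $i_0,\dots,i_r\in\{1,2\}$ not all equal to $2$, $\frac1N\sum_{n\le N} z(n)^{i_0} z(n+a_1)^{i_1}\cdots z(n+a_r)^{i_r}\to 0$ as $N\to\infty$. *)

(* Defs.v *)
From HB Require Import structures.
From mathcomp Require Import all_boot all_order all_algebra.
From mathcomp Require Import all_classical all_reals all_analysis.

Set Implicit Arguments.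
Unset Strict Implicit.
Unset Printing Implicit Defensive.

Import Order.TTheory GRing.Theory Num.Theory.
Import numFieldNormedType.Exports.

Local Open Scope classical_set_scope.
Local Open Scope ring_scope.

(* A sequence indexed by the positive integers is represented by a function on
   nat that is shifted by one: [w i] is the term of index [i.+1].  The sums over
   [1 <= n <= N] are therefore sums over [i < N]. *)

Definition appears (A : Type) (w : nat -> A) (n : nat) (b : n.-tuple A) : Prop :=
  exists t : nat, forall i : 'I_n, tnth b i = w (t + i)%N.

Definition nblocks (A : finType) (w : nat -> A) (n : nat) : nat :=
  #|[pred b : n.-tuple A | `[< appears w b >]]|.

Definition log2 (R : realType) (x : R) : R := ln x / ln 2.

(* Saying that the limit defining the entropy exists and equals h avoids the
   default value of [lim] on divergent sequences. *)
Definition is_htop (R : realType) (A : finType) (w : nat -> A) (h : R) : Prop :=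
  log2 (nblocks w n)%:R / n%:R @[n --> \oo] --> h.

Definition sturmian (eta : nat -> bool) : Prop :=
  forall n : nat, (0 < n)%N -> nblocks eta n = n.+1.

Definition num1 (n : nat) (b : n.-tuple bool) : nat := count_mem true b.

Definition bounds_num1 (R : realType) (eta : nat -> bool) (delta : R) : Prop :=
  \forall n \near \oo, forall b : n.-tuple bool, appears eta b ->
    delta * n%:R - 3 < (num1 b)%:R < delta * n%:R + 3.

Definition trit : Type := seq_sub ([:: -1; 0; 1] : seq int).

HB.instance Definition _ := Finite.on trit.

Lemma trit0_subproof : 0 \in ([:: -1; 0; 1] : seq int).
Proof. by []. Qed.

Lemma trit1_subproof : 1 \in ([:: -1; 0; 1] : seq int).
Proof. by []. Qed.

Definition trit0 : trit := SeqSub trit0_subproof.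
Definition trit1 : trit := SeqSub trit1_subproof.

HB.instance Definition _ := isPointed.Build trit trit0.

Definition trit_int (x : trit) : int := ssval x.

Lemma trit_mul_subproof (x y : trit) :
  trit_int x * trit_int y \in ([:: -1; 0; 1] : seq int).
Proof.
by case: x y => [x /= + [y /=]]; rewrite !inE =>
  /or3P[] /eqP -> /or3P[] /eqP ->.
Qed.

Definition trit_mul (x y : trit) : trit := SeqSub (trit_mul_subproof x y).

Definition trit_of_bool (b : bool) : trit := if b then trit1 else trit0.

Definition bool_mul_seq (eta : nat -> bool) (u : nat -> trit) : nat -> trit :=
  fun n => trit_mul (trit_of_bool (eta n)) (u n).

Definition sqr_seq (z : nat -> trit) : nat -> trit :=
  fun n => trit_mul (z n) (z n).

(* The space of sequences with the product of the discrete topologies, and the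
   same space with its Borel sigma-algebra. *)
Definition trit_seq := prod_topology (fun _ : nat => discrete_topology trit).

HB.instance Definition _ := Topological.on trit_seq.
HB.instance Definition _ := Pointed.on trit_seq.

Definition borel (X : ptopologicalType) := g_sigma_algebraType (@open X).

Definition shift_seq (k : nat) (u : trit_seq) : trit_seq := fun n => u (n + k)%N.

Definition weak_cvg (R : realType) (X : ptopologicalType)
    (mu : nat -> {measure set (borel X) -> \bar R})
    (nu : {measure set (borel X) -> \bar R}) : Prop :=
  forall f : X -> R, continuous f -> bounded_fun f ->
    (\int[mu N]_x (f x)%:E)%E @[N --> \oo] --> (\int[nu]_x (f x)%:E)%E.

(* The index k of [msum] runs over [k < N], hence the exponents of the shift are
   1, ..., N; the value at N = 0 is the null measure. *)
Definition empirical (R : realType) (u : trit_seq) (N : nat) :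
    {measure set (borel trit_seq) -> \bar R} :=
  mscale ((N%:R : R)^-1)%:nng
    (msum (fun k => \d_(shift_seq k.+1 u : borel trit_seq)) N).

Definition generic (R : realType) (u : trit_seq)
    (nu : {measure set (borel trit_seq) -> \bar R}) : Prop :=
  weak_cvg (empirical R u) nu.

(* A probability on the Borel sigma-algebra is determined by its values on the
   cylinders, so this characterizes the product measure of weights p. *)
Definition is_product_measure (R : realType) (p : trit -> R)
    (nu : probability (borel trit_seq) R) : Prop :=
  forall (n : nat) (b : n.-tuple trit),
    nu [set w : trit_seq | forall i : 'I_n, w i = tnth b i] =
    (\prod_(i < n) p (tnth b i))%:E.

Definition weight (R : realType) (x : trit) : R :=
  if trit_int x == 0 then 1 / 2 else 1 / 4.

Definition trit_val (R : realType) (x : trit) : R := (trit_int x)%:~R.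

Definition condition_Ch (R : realType) (z : nat -> trit) : Prop :=
  forall (r : nat) (a : 'I_r -> nat) (e : 'I_r.+1 -> nat),
    (forall j, (0 < a j)%N) ->
    (forall j k : 'I_r, (j < k)%N -> (a j < a k)%N) ->
    (forall j, e j = 1%N \/ e j = 2%N) ->
    (exists j, e j <> 2%N) ->
    N%:R^-1 * (\sum_(n < N)
      (trit_val R (z n) ^+ e ord0 *
       \prod_(j < r) trit_val R (z (n + a j)%N) ^+ e (lift ord0 j)))
      @[N --> \oo] --> (0 : R).

(* Main.v *)
(* The sequence eta has at most n + 1 blocks of length n, while for a mean-zero
   function g of K coordinates the sums of L independent terms g(u(t + jK)),
   with coefficients bounded by 1, have fourth moment at most 3 L^2.  A union
   bound over the at most LK + 1 patterns of eta in a window of length LK thus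
   shows that the averages of f(eta(t), ...) g(u(t), ...) tend to 0.  Taking for
   g a monomial with an exponent 1 gives (Ch).  Taking for g the centered
   indicators of words, one finds for each n a block B of eta that occurs
   together with every block of u.  Hence z has at least k^(#1 B) blocks of
   length n, and at most (n + 1) k^(delta n + 3) of them, with k = 3 for z and
   k = 2 for z^2.

   For the realization, eta is the mechanical word of slope delta, and a normal
   u is chosen greedily: the mean over the next symbol of a weighted sum of the
   squared discrepancies of all words increases by at most 1, so some next
   symbol keeps that sum below n, and each discrepancy is O(sqrt n). *)

Require Import Defs.
From mathcomp Require Import all_boot all_order all_algebra.
From mathcomp Require Import all_classical all_reals all_analysis.
From mathcomp Require Import zify ring lra.

Set Implicit Arguments.
Unset Strict Implicit.
Unset Printing Implicit Defensive.

Import Order.TTheory GRing.Theory Num.Theory.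
Import numFieldNormedType.Exports.

Local Open Scope classical_set_scope.
Local Open Scope ring_scope.

(** * Blocks and averages *)

Section Blocks.
Variables (T : Type) (w : nat -> T).

(** Lists rather than tuples, so that cutting and concatenating at variable lengths needs no cast;
    [appearsP] makes the link with [appears]. *)
Definition block (t n : nat) : seq T := map w (iota t n).

Lemma size_block t n : size (block t n) = n.
Proof. by rewrite size_map size_iota. Qed.

Lemma nth_block x0 t n i : (i < n)%N -> nth x0 (block t n) i = w (t + i).
Proof. by move=> ltin; rewrite (nth_map 0%N) ?size_iota// nth_iota. Qed.

Lemma block_cat t m n : block t (m + n) = block t m ++ block (t + m) n.
Proof. by rewrite /block iotaD map_cat. Qed.

Lemma block_rcons t n : block t n.+1 = rcons (block t n) (w (t + n)).
Proof. by rewrite -addn1 block_cat cats1. Qed.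

Lemma take_drop_block t i k n : (i + k <= n)%N ->
  take k (drop i (block t n)) = block (t + i) k.
Proof.
move=> le_ikn; rewrite /block -map_drop -map_take drop_iota take_iota addnC.
by congr (map _ (iota _ _)); lia.
Qed.

Lemma appearsP n (b : n.-tuple T) :
  appears w b <-> exists t, block t n = b.
Proof.
split=> [[t bE]|[t bE]]; exists t.
  case: n b bE => [|n] b bE; first by rewrite tuple0.
  apply: (@eq_from_nth _ (w 0)); rewrite ?size_block ?size_tuple// => i ltin.
  by rewrite nth_block// -(bE (Ordinal ltin)) (tnth_nth (w 0)).
by move=> i; rewrite (tnth_nth (w 0)) -bE nth_block.
Qed.

End Blocks.

Section CountBlocks.
Variables (A : finType) (w : nat -> A).

Lemma nblocks_le n (l : seq (seq A)) :
  (forall t, block w t n \in l) -> (nblocks w n <= size l)%N.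
Proof.
move=> wl; rewrite /nblocks cardE -(size_map val).
apply: uniq_leq_size; first by rewrite (map_inj_uniq val_inj) enum_uniq.
move=> _ /mapP[b + ->]; rewrite mem_enum inE /= => wb.
have [t /= <-] := (appearsP w b).1 wb.
exact: wl.
Qed.

Lemma nblocks_ge n (l : seq (seq A)) : uniq l ->
  (forall s, s \in l -> exists t, block w t n = s) -> (size l <= nblocks w n)%N.
Proof.
move=> ul lw; rewrite /nblocks cardE -(size_map val).
apply: uniq_leq_size => // s /lw[t ws].
have sz : size s == n by rewrite -ws size_block.
apply/mapP; exists (Tuple sz) => //; rewrite mem_enum inE.
by apply/(appearsP w (Tuple sz)); exists t.
Qed.

End CountBlocks.

Section Averages.
Variable R : realType.
Implicit Types x y : nat -> R.

Definition avg x (N : nat) : R := N%:R^-1 * \sum_(t < N) x t.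

Lemma eq_avg x y : x =1 y -> avg x = avg y.
Proof. by move/funext->. Qed.

Lemma avgD x y N : avg (fun t => x t + y t) N = avg x N + avg y N.
Proof. by rewrite /avg big_split mulrDr. Qed.

Lemma avgZ a x N : avg (fun t => a * x t) N = a * avg x N.
Proof. by rewrite /avg -mulr_sumr mulrCA. Qed.

Lemma avg_sum (I : Type) (r : seq I) (P : pred I) (x : I -> nat -> R) N :
  avg (fun t => \sum_(i <- r | P i) x i t) N = \sum_(i <- r | P i) avg (x i) N.
Proof. by rewrite /avg exchange_big -mulr_sumr. Qed.

Lemma avg_cst a N : (0 < N)%N -> avg (fun=> a) N = a.
Proof.
move=> N0; rewrite /avg sumr_const card_ord -[a *+ N]mulr_natl mulrA mulVf ?mul1r//.
by rewrite pnatr_eq0; lia.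
Qed.

Lemma cvg_avg_cst a : avg (fun=> a) @ \oo --> a.
Proof.
apply: cvg_near_cst; exists 1%N => // N /= N0.
exact: avg_cst.
Qed.

Lemma le_avg x y N : (forall t, x t <= y t) -> avg x N <= avg y N.
Proof. by move=> le_xy; rewrite ler_wpM2l ?invr_ge0// ler_sum. Qed.

Lemma ler_norm_avg x N : `|avg x N| <= avg (fun t => `|x t|) N.
Proof.
by rewrite normrM ger0_norm ?invr_ge0// ler_wpM2l ?invr_ge0// ler_norm_sum.
Qed.

Lemma cvg_avgD x y a b : avg x @ \oo --> a -> avg y @ \oo --> b ->
  avg (fun t => x t + y t) @ \oo --> a + b.
Proof.
move=> xa yb; rewrite (_ : avg _ = avg x \+ avg y); first exact: cvgD.
by apply/funext => N; rewrite avgD.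
Qed.

Lemma cvg_avgZ a x b : avg x @ \oo --> b -> avg (fun t => a * x t) @ \oo --> a * b.
Proof.
move=> xb; rewrite (_ : avg _ = (fun N => a * avg x N)); first exact: cvgMl_tmp.
by apply/funext => N; rewrite avgZ.
Qed.

Lemma cvg_sumr (I : Type) (r : seq I) (P : pred I) (x : I -> nat -> R) (a : I -> R) :
  (forall i, P i -> x i @ \oo --> a i) ->
  \sum_(i <- r | P i) x i N @[N --> \oo] --> \sum_(i <- r | P i) a i.
Proof. by move=> xa; apply: cvg_big => //; exact: add_continuous. Qed.

Lemma cvg_avg_sum (I : Type) (r : seq I) (P : pred I) (x : I -> nat -> R) (a : I -> R) :
  (forall i, P i -> avg (x i) @ \oo --> a i) ->
  avg (fun t => \sum_(i <- r | P i) x i t) @ \oo --> \sum_(i <- r | P i) a i.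
Proof.
move=> xa; rewrite (_ : avg _ = (fun N => \sum_(i <- r | P i) avg (x i) N)).
  exact: cvg_sumr.
by apply/funext => N; rewrite avg_sum.
Qed.

Lemma cvg_divn a : a / N%:R @[N --> \oo] --> (0 : R).
Proof.
rewrite -(mulr0 a); apply: cvgMl_tmp.
rewrite -(cvg_shiftS (fun N => N%:R^-1 : R)).
exact: cvg_harmonic.
Qed.

(** After cancellation only [m] terms at each end remain, so the averages differ by at most 2m/N. *)
Lemma cvg_avg_shift x m : (forall t, `|x t| <= 1) ->
  avg (fun t => x (t + m)%N) N - avg x N @[N --> \oo] --> 0.
Proof.
move=> x1; apply/cvgr0Pnorm_le => e e0.
have: \forall N \near \oo, `|2 * m%:R / N%:R : R| <= e.
  by move: e e0; apply/cvgr0Pnorm_le; exact: cvg_divn.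
apply: filterS => N; apply: le_trans.
rewrite /avg -mulrBr normrM [leLHS]mulrC normrM ler_wpM2r//.
rewrite [`|2 * _|]ger0_norm ?mulr_ge0//.
have sumE : \sum_(t < N) x (t + m)%N - \sum_(t < N) x t =
    \sum_(t < m) x (N + t)%N - \sum_(t < m) x t.
  have sumNm : \sum_(t < N + m) x t = \sum_(t < N) x t + \sum_(t < m) x (N + t)%N.
    by rewrite big_split_ord.
  have summN : \sum_(t < m + N) x t = \sum_(t < m) x t + \sum_(t < N) x (t + m)%N.
    rewrite big_split_ord; congr (_ + _).
    by apply: eq_bigr => t _; rewrite [in RHS]addnC.
  by move: sumNm summN; rewrite addnC => -> eqS; lra.
rewrite sumE; apply: le_trans (ler_normB _ _) _.
have le_m y : (forall t, `|y t| <= 1) -> `|\sum_(t < m) y t| <= m%:R :> R.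
  move=> y1; apply: le_trans (ler_norm_sum _ _ _) _.
  by rewrite -[in leRHS](card_ord m) -sumr_const ler_sum.
have := le_m (fun t => x (N + t)%N) (fun t => x1 _); have := le_m x x1; lra.
Qed.

(** Absorbs two offsets: the shifts in [empirical] start at 1, and a greedy test is active only from
    its own index on. *)
Lemma cvg_avg_addn x m (l : R) : (forall t, `|x t| <= 1) ->
  avg (fun t => x (t + m)%N) @ \oo --> l <-> avg x @ \oo --> l.
Proof.
move=> x1; have shift0 := cvg_avg_shift m x1; split=> xl.
- rewrite (_ : avg x = fun N =>
      avg (fun t => x (t + m)%N) N - (avg (fun t => x (t + m)%N) N - avg x N)).
    by rewrite -[l]subr0; exact: cvgB.
  by apply/funext => N; rewrite opprB addrC subrK.
- rewrite (_ : avg (fun t => x (t + m)%N) = fun N =>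
      avg (fun t => x (t + m)%N) N - avg x N + avg x N).
    by rewrite -[l]add0r; exact: cvgD.
  by apply/funext => N; rewrite subrK.
Qed.

End Averages.

(** * Independent letters and normal sequences *)

Section Expectation.
Variables (R : realType) (A : finType) (p : A -> R).
Hypotheses (p_ge0 : forall x, 0 <= p x) (p_sum1 : \sum_x p x = 1).
Implicit Types F G : seq A -> R.

(* The mean of F over words of length n with independent letters of law p. *)
Fixpoint expect (n : nat) F : R :=
  if n is m.+1 then \sum_x p x * expect m (fun s => F (x :: s)) else F [::].

Lemma eq_expect n F G : (forall s, size s = n -> F s = G s) ->
  expect n F = expect n G.
Proof.
elim: n F G => [|n IHn] F G FG /=; first exact: FG.
by apply: eq_bigr => x _; congr (_ * _); apply: IHn => s sn; rewrite FG//= sn.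
Qed.

Lemma expectD n F G : expect n (fun s => F s + G s) = expect n F + expect n G.
Proof.
elim: n F G => [//|n IHn] F G /=.
by rewrite -big_split; apply: eq_bigr => x _; rewrite IHn mulrDr.
Qed.

Lemma expectZ n a F : expect n (fun s => a * F s) = a * expect n F.
Proof.
elim: n F => [//|n IHn] F /=.
by rewrite mulr_sumr; apply: eq_bigr => x _; rewrite IHn mulrCA.
Qed.

Lemma expect_cst n a : expect n (fun=> a) = a.
Proof.
elim: n => [//|n /= ->].
by rewrite -mulr_suml p_sum1 mul1r.
Qed.

Lemma expectB n F G : expect n (fun s => F s - G s) = expect n F - expect n G.
Proof.
rewrite -mulN1r -expectZ -expectD; apply: eq_expect => s _.
by rewrite mulN1r.
Qed.

Lemma le_expect n F G : (forall s, size s = n -> F s <= G s) ->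
  expect n F <= expect n G.
Proof.
elim: n F G => [|n IHn] F G FG /=; first exact: FG.
apply: ler_sum => x _; rewrite ler_wpM2l//.
by apply: IHn => s sn; rewrite FG//= sn.
Qed.

Lemma expect_cat m n F :
  expect (m + n) F = expect m (fun s => expect n (fun t => F (s ++ t))).
Proof.
elim: m F => [//|m IHm] F; rewrite addSn /=.
by apply: eq_bigr => x _; rewrite IHm.
Qed.

Lemma expect_prod n (phi : nat -> A -> R) x0 :
  expect n (fun s => \prod_(i < n) phi i (nth x0 s i)) =
  \prod_(i < n) \sum_x p x * phi i x.
Proof.
elim: n phi => [|n IHn] phi /=; first by rewrite !big_ord0.
rewrite big_ord_recl -(IHn (phi \o succn)) mulr_suml; apply: eq_bigr => x _.
rewrite -[RHS]mulrA -[in RHS]expectZ; congr (p x * _); apply: eq_expect => s _.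
by rewrite big_ord_recl.
Qed.

Lemma expect_word (s : seq A) :
  expect (size s) (fun t => (t == s)%:R) = \prod_(x <- s) p x.
Proof.
elim: s => [|x s IHs] /=; first by rewrite big_nil.
rewrite big_cons -IHs (bigD1 x)//= big1 ?addr0; last first.
  move=> y yx; rewrite -[RHS](mulr0 (p y)) -[in RHS](expect_cst (size s) 0).
  by congr (_ * _); apply: eq_expect => t _; rewrite eqseq_cons (negPf yx).
by congr (_ * _); apply: eq_expect => t _; rewrite eqseq_cons eqxx.
Qed.

(** Genericity for the product measure of weights [p], expressed through frequencies of words
    alone. *)
Definition normal (u : nat -> A) : Prop := forall s : seq A,
  avg (fun t => (block u t (size s) == s)%:R) @ \oo --> \prod_(x <- s) p x.

Lemma normal_cvg_avg u n F : normal u ->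
  avg (fun t => F (block u t n)) @ \oo --> expect n F.
Proof.
move=> nu.
(* The prefix [s] is added so that the induction on [n] can move the first letter of the window into
   it. *)
suff: forall s, avg (fun t => (block u t (size s) == s)%:R *
    F (block u (t + size s) n)) @ \oo --> (\prod_(x <- s) p x) * expect n F.
  move=> /(_ [::]); rewrite big_nil mul1r.
  by under eq_avg => t do rewrite /= mul1r addn0.
elim: n F => [|n IHn] F s /=.
  rewrite mulrC; under eq_avg => t do rewrite mulrC.
  exact/cvg_avgZ/nu.
have -> : (\prod_(x <- s) p x) * \sum_x p x * expect n (fun t => F (x :: t)) =
    \sum_x (\prod_(y <- rcons s x) p y) * expect n (fun t => F (x :: t)).
  rewrite mulr_sumr; apply: eq_bigr => x _.
  by rewrite -cats1 big_cat big_seq1/= mulrA.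
suff splitF t : (block u t (size s) == s)%:R *
      F (u (t + size s)%N :: block u (t + size s).+1 n) =
    \sum_x (block u t (size (rcons s x)) == rcons s x)%:R *
      F (x :: block u (t + size (rcons s x)) n).
  under eq_avg => t do rewrite splitF.
  by apply: cvg_avg_sum => x _; apply: (IHn (fun t => F (x :: t))).
rewrite (bigD1 (u (t + size s)%N))//= big1 ?addr0 => [|x xu].
  by rewrite size_rcons block_rcons eqseq_rcons eqxx andbT addnS.
by rewrite size_rcons block_rcons eqseq_rcons [_ == x]eq_sym (negPf xu) andbF mul0r.
Qed.

Section FourthMoment.
Variables (K : nat) (g : seq A -> R).
Hypotheses (g_le1 : forall s, `|g s| <= 1) (g_mean0 : expect K g = 0).

(** The windows are consecutive and disjoint, hence the values of [g] are independent; [c] will be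
    read off a word of [eta]. *)
Definition wsum (L : nat) (c : nat -> R) (s : seq A) : R :=
  \sum_(j < L) c j * g (take K (drop (j * K) s)).

Lemma wsum_cat L c s t : size s = K ->
  wsum L.+1 c (s ++ t) = c 0%N * g s + wsum L (c \o succn) t.
Proof.
move=> sK; rewrite /wsum big_ord_recl mul0n drop0 -{1}sK take_size_cat//.
congr (_ + _); apply: eq_bigr => j _; congr (_ * g (take K _)).
by rewrite /= mulSn -{1}sK drop_cat ltnNge leq_addr/= addKn.
Qed.

(** Conditioning on the first window; [Q] will be the powers 1, 2 and 4. *)
Lemma expect_wsumS L c (Q : R -> R) :
  expect (L.+1 * K) (fun s => Q (wsum L.+1 c s)) =
  expect K (fun s => expect (L * K)
     (fun t => Q (c 0%N * g s + wsum L (c \o succn) t))).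
Proof.
rewrite mulSn expect_cat; apply: eq_expect => s sK; apply: eq_expect => t _.
by rewrite wsum_cat.
Qed.

Lemma norm_le1_sqr (x : R) : `|x| <= 1 -> x ^+ 2 <= 1.
Proof. by move=> x1; rewrite -real_normK ?num_real// expr_le1. Qed.

(* A second moment bound O(L) would not survive the union over LK + 1 patterns
   in [decorrelation]. *)
Lemma wsum_moments L c : (forall j, `|c j| <= 1) ->
  [/\ expect (L * K) (wsum L c) = 0,
      expect (L * K) (fun s => wsum L c s ^+ 2) <= L%:R
    & expect (L * K) (fun s => wsum L c s ^+ 4) <= 3 * L%:R ^+ 2].
Proof.
elim: L c => [|L IHL] c c1.
  by rewrite mul0n /= /wsum big_ord0 !expr0n/= mulr0 !lexx.
have [|E1 E2 E4] := IHL (c \o succn); first by move=> j; exact: c1.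
set T := wsum L (c \o succn) in E1 E2 E4.
set E := expect (L * K) in E1 E2 E4.
pose X s := c 0%N * g s.
have X2 s : X s ^+ 2 <= 1.
  by apply: norm_le1_sqr; rewrite normrM mulr_ile1.
have EX : expect K X = 0 by rewrite expectZ g_mean0 mulr0.
have stepE (Q : R -> R) : expect (L.+1 * K) (fun s => Q (wsum L.+1 c s)) =
    expect K (fun s => E (fun t => Q (X s + T t))).
  exact: expect_wsumS.
have ET2_ge0 : 0 <= E (fun t => T t ^+ 2).
  by rewrite -(expect_cst (L * K) 0); apply: le_expect => t _; exact: sqr_ge0.
split.
- rewrite (stepE id) -EX; apply: eq_expect => s _.
  by rewrite /E expectD expect_cst [X in _ + X]E1 addr0.
- rewrite (stepE (fun x => x ^+ 2)).
  have -> : expect K (fun s => E (fun t => (X s + T t) ^+ 2)) =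
      expect K (fun s => X s ^+ 2) + E (fun t => T t ^+ 2).
    rewrite -[X in _ = _ + X](expect_cst K) -expectD.
    apply: eq_expect => s _; transitivity
      (E (fun t => X s ^+ 2 + (2 * X s * T t + T t ^+ 2))).
      by apply: eq_expect => t _; ring.
    by rewrite /E !expectD expect_cst expectZ [expect _ T]E1 mulr0 add0r.
  have : expect K (fun s => X s ^+ 2) <= 1.
    by rewrite -[leRHS](expect_cst K); apply: le_expect => s _; exact: X2.
  by move=> ?; rewrite -natr1 addrC lerD.
rewrite (stepE (fun x => x ^+ 4)).
(* The term in [X ^+ 3 * T] vanishes because [T] has mean 0, the term in [X * T ^+ 3] because [X]
   has. *)
have -> : expect K (fun s => E (fun t => (X s + T t) ^+ 4)) =
    expect K (fun s => X s ^+ 4 + 6 * E (fun t => T t ^+ 2) * X s ^+ 2)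
    + E (fun t => T t ^+ 4).
  transitivity (expect K (fun s =>
      X s ^+ 4 + 6 * E (fun t => T t ^+ 2) * X s ^+ 2 +
      (E (fun t => T t ^+ 4) + 4 * E (fun t => T t ^+ 3) * X s))).
    apply: eq_expect => s _; transitivity
      (E (fun t => X s ^+ 4 + (4 * X s ^+ 3 * T t + (6 * X s ^+ 2 * T t ^+ 2 +
        (4 * X s * T t ^+ 3 + T t ^+ 4))))).
      by apply: eq_expect => t _; ring.
    by rewrite /E !expectD expect_cst !expectZ [expect _ T]E1; ring.
  by rewrite expectD [X in _ + X]expectD expectZ EX mulr0 addr0 expect_cst.
have : expect K (fun s => X s ^+ 4 + 6 * E (fun t => T t ^+ 2) * X s ^+ 2) <=
    1 + 6 * E (fun t => T t ^+ 2).
  rewrite -[leRHS](expect_cst K); apply: le_expect => s _.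
  apply: lerD; last by rewrite ler_piMr ?mulr_ge0.
  by rewrite (exprM _ 2 2) expr_le1 ?sqr_ge0.
(* The total is at most 1 + 6L + 3L^2, which is below 3(L + 1)^2. *)
move: E2 E4; lra.
Qed.

End FourthMoment.
End Expectation.

(** * Decorrelation from sequences of low complexity *)

Section Decorrelation.
Variables (R : realType) (A D : finType) (p : A -> R).
Hypotheses (p_ge0 : forall x, 0 <= p x) (p_sum1 : \sum_x p x = 1).
Variables (eta : nat -> D) (u : nat -> A).
Hypotheses (eta_low : forall n, (0 < n)%N -> (nblocks eta n <= n.+1)%N)
  (u_normal : normal p u).

(** Turns a fourth moment into a bound on a mean absolute value: up to [d] the first term suffices,
    beyond [d] the second. *)
Lemma le_add_expr4 (d x : R) : 0 < d -> `|x| <= d + d ^- 3 * x ^+ 4.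
Proof.
move=> d0; have d3 : 0 < d ^+ 3 by rewrite exprn_gt0.
rewrite -(ler_pM2l d3) mulrDr mulrA divff ?gt_eqF// mul1r.
have -> : x ^+ 4 = `|x| ^+ 4 by rewrite -normrX ger0_norm// (exprM _ 2 2) sqr_ge0.
have := normr_ge0 x; move: (`|x|) => y y0.
have [yd|dy] := leP y d.
  have : d ^+ 3 * y <= d ^+ 3 * d by rewrite ler_pM2l.
  have : 0 <= y ^+ 4 by rewrite exprn_ge0.
  lra.
have : d ^+ 3 * y <= y ^+ 3 * y by rewrite ler_wpM2r// lerXn2r// ?nnegrE; exact: ltW.
have : 0 <= d ^+ 3 * d by rewrite mulr_ge0 ?ltW.
by rewrite -exprSr; lra.
Qed.

Let pattern K (f : seq D -> R) (b : seq D) (j : nat) : R :=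
  f (take K (drop (j * K) b)).

(** Summing over all patterns of [eta] leaves a function of [u] alone, to which normality applies;
    no joint frequency of [eta] and [u] has to be known. *)
Lemma decorrelation K (f : seq D -> R) (g : seq A -> R) : (0 < K)%N ->
  (forall s, `|f s| <= 1) -> (forall s, `|g s| <= 1) -> expect p K g = 0 ->
  avg (fun t => f (block eta t K) * g (block u t K)) @ \oo --> 0.
Proof.
move=> K0 f1 g1 g0; set a := fun t => _.
have a1 t : `|a t| <= 1 by rewrite normrM mulr_ile1.
apply/cvgr0Pnorm_le => e e0.
pose d := e / 4; have d0 : 0 < d by rewrite divr_gt0.
have d4 : 0 < d ^+ 4 by rewrite exprn_gt0.
(* At most LK + 1 <= L(K + 1) patterns, each with fourth moment at most 3/L^2 after division by L,
   add up to 3(K + 1)/L; this [L] brings the sum below d^4. *)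
pose L := (Num.truncn (3 * K.+1%:R / d ^+ 4)).+1.
have L0 : 0 < L%:R :> R by rewrite ltr0n.
have LE : 3 * K.+1%:R / L%:R <= d ^+ 4.
  rewrite ler_pdivrMr// [leRHS]mulrC -ler_pdivrMr//; exact/ltW/truncnS_gt.
pose x b s := L%:R^-1 * wsum K g L (pattern K f b) s.
pose M := (L * K)%N.
have M0 : (0 < M)%N by rewrite muln_gt0.
(* Averaging [a] over [L] places at distance [K] does not affect the limit of its averages and makes
   the windows disjoint. *)
pose W t := L%:R^-1 * \sum_(j < L) a (t + j * K)%N.
have WE t : W t = x (block eta t M) (block u t M).
  congr (_ * _); apply: eq_bigr => j _; rewrite /pattern !take_drop_block//.
    by rewrite /M addnC -mulSn leq_mul2r ltn_ord orbT.
  by rewrite /M addnC -mulSn leq_mul2r ltn_ord orbT.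
have shiftW : avg W N - avg a N @[N --> \oo] --> 0.
  rewrite (_ : (fun N => _) = fun N =>
      L%:R^-1 * \sum_(j < L) (avg (fun t => a (t + j * K)%N) N - avg a N)).
    have := cvgMl_tmp (a := L%:R^-1) (cvg_sumr (r := index_enum 'I_L)
      (P := xpredT) (fun j _ => cvg_avg_shift (j * K) a1)).
    rewrite big1// mulr0 => HW; exact: HW.
  apply/funext => N; rewrite /W avgZ avg_sum sumrB mulrBr sumr_const card_ord.
  by rewrite -[avg a N *+ L]mulr_natl mulrA mulVf ?mul1r// gt_eqF.
(* The pattern of [eta] seen at [t] is one of the summands, and all of them are nonnegative. *)
pose Y t := \sum_(b : M.-tuple D | `[< appears eta b >]) x b (block u t M) ^+ 4.
have WY t : `|W t| <= d + d ^- 3 * Y t.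
  apply: le_trans (le_add_expr4 _ d0) _; rewrite lerD2l ler_wpM2l//.
    by rewrite invr_ge0 exprn_ge0// ltW.
  have szb : size (block eta t M) == M by rewrite size_block.
  rewrite WE /Y (bigD1 (Tuple szb))/=; last first.
    by apply/asboolP/(appearsP eta (Tuple szb)); exists t.
  by rewrite lerDl sumr_ge0// => b _; rewrite (exprM _ 2 2) sqr_ge0.
pose l := \sum_(b : M.-tuple D | `[< appears eta b >]) expect p M (fun s => x b s ^+ 4).
have Yl : avg Y @ \oo --> l.
  apply: cvg_avg_sum => b _.
  exact: (normal_cvg_avg (F := fun s => x b s ^+ 4) u_normal).
have l_le : l <= d ^+ 4.
  apply: le_trans LE.
  have xb b : expect p M (fun s => x b s ^+ 4) <= L%:R ^- 4 * (3 * L%:R ^+ 2).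
    rewrite (@eq_expect _ _ _ _ _ (fun s => L%:R ^- 4 * wsum K g L (pattern K f b) s ^+ 4)).
      rewrite expectZ ler_pM2l ?invr_gt0 ?exprn_gt0//.
      by have [] := wsum_moments p_ge0 p_sum1 g1 g0 L (c := pattern K f b) (fun j => f1 _).
    by move=> s _; rewrite /x exprMn exprVn.
  apply: (@le_trans _ _ (\sum_(b : M.-tuple D | `[< appears eta b >])
    L%:R ^- 4 * (3 * L%:R ^+ 2))); first exact: ler_sum.
  have -> : L%:R ^- 4 * (3 * L%:R ^+ 2) = 3 / L%:R ^+ 2 :> R.
    by field; rewrite gt_eqF.
  rewrite sumr_const -[_ *+ _]mulr_natr -/(nblocks eta M).
  apply: (@le_trans _ _ (3 / L%:R ^+ 2 * (L%:R * K.+1%:R))).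
    rewrite ler_wpM2l ?divr_ge0 ?exprn_ge0//.
    rewrite -natrM ler_nat (leq_trans (eta_low M0))// mulnS -[M.+1]add1n.
    by rewrite leq_add2r.
  by rewrite le_eqVlt; apply/orP; left; apply/eqP; field; rewrite gt_eqF.
have ZE : avg (fun t => d + d ^- 3 * Y t) @ \oo --> d + d ^- 3 * l.
  by apply: cvg_avgD; [exact: cvg_avg_cst | exact: cvg_avgZ].
(* The limit is in fact at most 2d; the slack makes the averages eventually at most 3d, and the
   fourth part of [e] pays for replacing [a] by [W]. *)
have lt3d : d + d ^- 3 * l < 3 * d.
  have : d ^- 3 * l <= d ^- 3 * d ^+ 4.
    by rewrite ler_wpM2l// invr_ge0 exprn_ge0// ltW.
  have -> : d ^- 3 * d ^+ 4 = d by field; rewrite gt_eqF.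
  lra.
have near1 : \forall N \near \oo, `|avg W N - avg a N| <= d.
  by move/cvgr0Pnorm_le: shiftW; apply.
have near2 : \forall N \near \oo, avg (fun t => d + d ^- 3 * Y t) N <= 3 * d.
  exact: (cvgr_le _ ZE).
apply: filterS2 near1 near2 => N N1 N2.
have N3 : `|avg W N| <= 3 * d.
  by apply: le_trans (ler_norm_avg _ _) _; apply: le_trans N2; exact: le_avg.
have -> : avg a N = avg W N - (avg W N - avg a N) by ring.
have -> : e = 3 * d + d by rewrite /d; field.
by apply: le_trans (ler_normB _ _) _; rewrite lerD.
Qed.

(** Otherwise each B has a word C(B) never seen with it, so the centered indicator of C(B) is the
    constant -q at the occurrences of B. Decorrelation then gives B frequency 0, but the frequencies
    of the finitely many B add up to 1. *)
Lemma joint_block n : (forall x, 0 < p x) -> (0 < n)%N ->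
  exists B : n.-tuple D, forall C : n.-tuple A,
    exists t, block eta t n = B /\ block u t n = C.
Proof.
move=> p_gt0 n0; apply: contrapT => /forallNP noB.
have {}noB (B : n.-tuple D) : exists C : n.-tuple A,
    forall t, ~ (block eta t n = B /\ block u t n = C).
  by have /existsNP[C /forallNP noC] := noB B; exists C.
have {noB} [C noC] := choice noB.
have freq0 (B : n.-tuple D) :
    avg (fun t => (block eta t n == B)%:R) @ \oo --> (0 : R).
  pose q : R := \prod_(x <- C B) p x.
  have q0 : 0 < q by apply: prodr_gt0.
  have q1 : q <= 1.
    rewrite /q -(expect_word p_sum1) -[leRHS](expect_cst p_sum1 (size (C B))).
    by apply: le_expect => // s _; case: (_ == _).
  pose g (s : seq A) : R := (s == C B)%:R - q.
  have g1 s : `|g s| <= 1.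
    by rewrite /g ler_norml; case: (_ == _) => /=; lra.
  have g0 : expect p n g = 0.
    rewrite expectB expect_cst// /q -(expect_word p_sum1) size_tuple.
    exact: subrr.
  have f1 s : `|(s == B :> seq D)%:R| <= 1 :> R.
    by case: (_ == _); rewrite ?normr1 ?normr0.
  have := cvg_avgZ (a := - q^-1) (decorrelation n0 f1 g1 g0); rewrite mulr0.
  under eq_avg => t.
    have -> : - q^-1 * ((block eta t n == B)%:R * g (block u t n)) = (block eta t n == B)%:R.
      case: eqP => [tB|]; rewrite ?mul0r ?mulr0// mul1r.
      rewrite /g; case: eqP => [tC|_]; first by case: (noC B t).
      by rewrite add0r mulrNN mulVf// gt_eqF.
    over.
  exact.
have sum1 : avg (fun t => \sum_(B : n.-tuple D) (block eta t n == B)%:R) = avg (fun=> 1 : R).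
  apply: eq_avg => t; have szb : size (block eta t n) == n by rewrite size_block.
  rewrite (bigD1 (Tuple szb))//= eqxx big1 ?addr0// => B.
  by rewrite eq_sym -val_eqE/= => /negPf ->.
have := cvg_avg_sum (r := index_enum _) (P := xpredT) (fun B _ => freq0 B).
rewrite sum1 big1// => to0.
have : 1 = 0 :> R by apply: (cvg_unique _ (@cvg_avg_cst R 1) to0).
by move/eqP; rewrite oner_eq0.
Qed.

End Decorrelation.

(** * Entropy *)

Section Fillings.
Variables (A : finType) (a0 : A) (vals : seq A).

(** The candidate blocks of the product above a block B of [eta]: a free letter of [vals] at each 1,
    the letter [a0] at each 0. *)
Fixpoint fillings (B : seq bool) : seq (seq A) :=
  if B is b :: B' then
    [seq x :: s | x <- if b then vals else [:: a0], s <- fillings B']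
  else [:: [::]].

Lemma size_fillings B : size (fillings B) = (size vals ^ count_mem true B)%N.
Proof.
elim: B => [//|b B IHB]; rewrite [fillings _]/= size_allpairs IHB.
by case: b => /=; rewrite ?mul1n// add1n expnS.
Qed.

Lemma size_mem_fillings B s : s \in fillings B -> size s = size B.
Proof.
elim: B s => [|b B IHB] s; first by rewrite inE => /eqP->.
by move=> /allpairsP[[x r] [_ /= /IHB rB ->]] /=; rewrite rB.
Qed.

Lemma fillings_uniq B : uniq vals -> uniq (fillings B).
Proof.
move=> uvals; elim: B => [//|b B IHB] /=.
apply: allpairs_uniq => //; first by case: b.
by move=> [x s] [y t] _ _ /= [-> ->].
Qed.

Lemma mem_fillings_cons b B x s : (x :: s \in fillings (b :: B)) =
  (x \in if b then vals else [:: a0]) && (s \in fillings B).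
Proof.
apply/allpairsP/andP => /= [[[y t] /= [yb tB [-> ->]]]|[xb sB]]; first by [].
by exists (x, s).
Qed.

Variables (op : bool -> A -> A) (eta : nat -> bool) (u : nat -> A).
Hypotheses (op_false : forall x, op false x = a0)
  (op_true : forall x, op true x \in vals)
  (op_vals : forall x, x \in vals -> op true x = x).

Lemma block_fillings t n :
  block (fun i => op (eta i) (u i)) t n \in fillings (block eta t n).
Proof.
elim: n t => [|n IHn] t; first by rewrite inE.
rewrite mem_fillings_cons IHn andbT.
by case: (eta t); rewrite ?op_true// op_false inE.
Qed.

(** [op] fixes a filling, so a filling that [u] shows together with its pattern in [eta] is itself a
    block of the product. *)
Lemma fillings_block t n : block u t n \in fillings (block eta t n) ->
  block (fun i => op (eta i) (u i)) t n = block u t n.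
Proof.
elim: n t => [//|n IHn] t; rewrite mem_fillings_cons => /andP[ut /IHn un].
rewrite /block/= -!/(block _ _ _) un; congr (_ :: _).
by move: ut; case: (eta t) => [/op_vals//|]; rewrite inE op_false => /eqP.
Qed.

End Fillings.

(* From [ln (d * n.+1) <= d * n.+1 - 1], for an arbitrarily small d. *)
Lemma cvg_ln_divn (R : realType) : ln n.+1%:R / n%:R @[n --> \oo] --> (0 : R).
Proof.
apply/cvgr0Pnorm_le => e e0.
pose d := e / 2; have d0 : 0 < d by rewrite divr_gt0.
(* The inequality reads ln(n + 1) <= dn + (d - 1 - ln d), whose bracket is below d - ln d. *)
have : \forall n \near \oo, `|(d - ln d) / n%:R| <= d.
  by move/cvgr0Pnorm_le: (cvg_divn (d - ln d)); apply.
apply: filterS2 (nbhs_infty_gt 0) => n n0 nd.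
have n0R : 0 < n%:R :> R by rewrite ltr0n.
rewrite ger0_norm ?divr_ge0 ?ln_ge0 ?ler1n//.
have lnD : ln (d * n.+1%:R) = ln d + ln n.+1%:R by rewrite lnM ?posrE ?ltr0n.
have : ln (1 + (d * n.+1%:R - 1)) <= d * n.+1%:R - 1.
  by apply: le_ln1Dx; rewrite ltrBrDl subrr mulr_gt0// ltr0n.
rewrite addrC subrK lnD -[n.+1%:R]natr1 => le_ln.
move: nd; rewrite ler_norml => /andP[_]; rewrite !ler_pdivrMr// => nd.
have -> : e = d + d by rewrite /d; field.
lra.
Qed.

Section Entropy.
Variables (R : realType) (A : finType) (p : A -> R).
Hypotheses (p_gt0 : forall x, 0 < p x) (p_sum1 : \sum_x p x = 1).
Variables (eta : nat -> bool) (u : nat -> A) (delta : R).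
Hypotheses (eta_low : forall n, (0 < n)%N -> (nblocks eta n <= n.+1)%N)
  (u_normal : normal p u) (eta_delta : bounds_num1 eta delta).

(** A general [op] covers the product, with three free letters, and its square, with two. *)
Lemma htop_fillings (a0 : A) (vals : seq A) (op : bool -> A -> A) :
  uniq vals -> (0 < size vals)%N ->
  (forall x, op false x = a0) -> (forall x, op true x \in vals) ->
  (forall x, x \in vals -> op true x = x) ->
  is_htop (fun i => op (eta i) (u i)) (delta * log2 (size vals)%:R).
Proof.
move=> uvals vals0 op_false op_true op_vals; set z := fun i => _.
pose k := size vals; pose c : R := ln k%:R.
have k0 : 0 < k%:R :> R by rewrite ltr0n.
have c0 : 0 <= c by rewrite ln_ge0// ler1n.
have l2 : 0 < ln 2 :> R by rewrite ln_gt0// ltr1n.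
have lower n (b : n.-tuple bool) : (forall C : n.-tuple A,
    exists t, block eta t n = b /\ block u t n = C) -> (k ^ num1 b <= nblocks z n)%N.
  move=> bC; rewrite -(size_fillings a0); apply: nblocks_ge.
    exact: fillings_uniq.
  move=> s sb; have ssz : size s == n by rewrite (size_mem_fillings sb) size_tuple.
  have [t [tb tC]] := bC (Tuple ssz).
  have {}tC : block u t n = s by [].
  by exists t; rewrite (fillings_block (a0 := a0) (vals := vals))// tC tb.
have upper n : (nblocks z n <=
    \sum_(b : n.-tuple bool | `[< appears eta b >]) k ^ num1 b)%N.
  pose P := [pred b : n.-tuple bool | `[< appears eta b >]].
  have := @nblocks_le _ z n (flatten [seq fillings a0 vals b | b : n.-tuple bool <- enum P]).
  rewrite size_flatten /shape -map_comp sumnE big_map big_enum/=.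
  under eq_bigr => b _ do rewrite size_fillings.
  apply=> t; apply/flattenP; exists (fillings a0 vals (block eta t n)).
    have szb : size (block eta t n) == n by rewrite size_block.
    apply/mapP; exists (Tuple szb) => //; rewrite mem_enum inE.
    by apply/(appearsP eta (Tuple szb)); exists t.
  exact: block_fillings.
(* The logarithms of k^(delta n - 3) and (n + 1) k^(delta n + 3), divided by n. *)
pose lo (n : nat) : R := delta * (c / ln 2) - (3 * c / ln 2) / n%:R.
pose hi (n : nat) : R := delta * (c / ln 2) + (3 * c / ln 2) / n%:R +
  (ln 2)^-1 * (ln n.+1%:R / n%:R).
apply: (@squeeze_cvgr _ _ _ _ lo hi); last 2 first.
- rewrite -[X in _ --> X]subr0; apply: cvgB; first exact: cvg_cst.
  exact: cvg_divn.
- rewrite -[X in _ --> X]addr0 -[X in _ --> X + _]addr0 -[X in _ --> _ + X](mulr0 (ln 2)^-1).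
  apply: cvgD; last by apply: cvgMl_tmp; exact: cvg_ln_divn.
  by apply: cvgD; [exact: cvg_cst | exact: cvg_divn].
apply: filterS2 (nbhs_infty_gt 0) eta_delta => n n0 nd.
have n0R : 0 < n%:R :> R by rewrite ltr0n.
have zn0 : (0 < nblocks z n)%N.
  apply: (@nblocks_ge _ z n [:: block z 0 n]) => // s.
  by rewrite inE => /eqP ->; exists 0%N.
have -> : lo n = (delta * n%:R - 3) * c / (ln 2 * n%:R).
  by rewrite /lo; field; rewrite !gt_eqF.
have -> : hi n = (ln n.+1%:R + (delta * n%:R + 3) * c) / (ln 2 * n%:R).
  by rewrite /hi; field; rewrite !gt_eqF.
have -> : log2 (nblocks z n)%:R / n%:R = ln (nblocks z n)%:R / (ln 2 * n%:R) :> R.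
  by rewrite /log2 invfM mulrA.
rewrite !ler_pM2r ?invr_gt0 ?mulr_gt0//.
have lnX m : ln (k ^ m)%N%:R = m%:R * c.
  by rewrite natrX lnXn// mulr_natl.
apply/andP; split.
  have [b bC] := joint_block (fun x => ltW (p_gt0 x)) p_sum1 eta_low u_normal p_gt0 n0.
  (* Any block of [u] would do here; the constant one provides an occurrence of [b]. *)
  have /nd/andP[nb _] : appears eta b.
    have s0 : size (nseq n a0) == n by rewrite size_nseq.
    by apply/appearsP; have [t [tb _]] := bC (Tuple s0); exists t.
  apply: (@le_trans _ _ (ln (k ^ num1 b)%N%:R)).
    by rewrite lnX ler_wpM2r// ltW.
  by rewrite ler_ln ?posrE ?ltr0n ?expn_gt0 ?vals0// ler_nat lower.
(* [expR m] is k^(delta n + 3) with a real exponent. *)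
pose m := (delta * n%:R + 3) * c.
apply: (@le_trans _ _ (ln (n.+1%:R * expR m))); last first.
  by rewrite lnM ?posrE ?ltr0n ?expR_gt0// expRK.
rewrite ler_ln ?posrE ?ltr0n ?mulr_gt0 ?ltr0n ?expR_gt0//.
have /(@le_trans _ R) : (nblocks z n)%:R <=
    \sum_(b : n.-tuple bool | `[< appears eta b >]) expR m.
  apply: (@le_trans _ _ (\sum_(b : n.-tuple bool | `[< appears eta b >])
    (k ^ num1 b)%N%:R)); first by rewrite -natr_sum ler_nat upper.
  apply: ler_sum => b /asboolP /nd /andP[_ bn].
  rewrite -[leLHS]lnK ?posrE ?ltr0n ?expn_gt0 ?vals0// ler_expR lnX.
  by rewrite ler_wpM2r// ltW.
apply; rewrite sumr_const -[_ *+ _]mulr_natl ler_wpM2r ?expR_ge0// ler_nat.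
exact: eta_low.
Qed.

End Entropy.

(** * Products with generic points *)

Section GenericPoints.
Variable R : realType.

(** Membership in a cylinder depends on finitely many discrete coordinates, so its indicator is
    locally constant and is an admissible test function for weak convergence. *)
Lemma generic_normal (u : trit_seq) (nu : probability (borel trit_seq) R) :
  is_product_measure (weight R) nu -> generic u nu -> normal (weight R) u.
Proof.
move=> nuE u_nu s.
pose b := in_tuple s; pose n := size s.
pose cyl : set trit_seq := [set w | forall i : 'I_n, w (nat_of_ord i) = tnth b i].
pose f : trit_seq -> R := \1_cyl.
have near_coord (x : trit_seq) :
    \forall y \near x, forall i : 'I_n, y (nat_of_ord i) = x (nat_of_ord i).
  apply: (@filter_forall trit_seq 'I_n _ (nbhs x) (nbhs_filter x)) => i.
  exact: (@proj_continuous _ (fun _ : nat => discrete_topology trit) i x _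
    (@discrete_set1 (discrete_topology trit) (x i))).
have f_locally_cst (x : trit_seq) : \forall y \near x, f y = f x.
  near=> y.
  have yx : forall i : 'I_n, y (nat_of_ord i) = x (nat_of_ord i).
    by near: y; exact: near_coord.
  congr (_%:R); congr (nat_of_bool _).
  by apply/idP/idP; rewrite !inE => xb i; rewrite ?yx// -yx.
have f_cont : continuous f.
  move=> x; exact: (@cvg_near_cst trit_seq R (f x) f (nbhs x) (nbhs_filter x)
    (f_locally_cst x)).
have f_bounded : bounded_fun f.
  exists 1; split => // M M1 x _; rewrite /f /indic/=.
  by case: (_ \in _); rewrite ?normr1 ?normr0 ltW// (lt_trans _ M1).
have cyl_open : open cyl.
  rewrite openE => x xb; rewrite /interior/=.
  apply: filterS (near_coord x) => y yx i.
  by rewrite yx.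
have cyl_meas : measurable (cyl : set (borel trit_seq)) by apply: sub_sigma_algebra.
have int_nu : (\int[nu]_x (f x)%:E)%E = (\prod_(x <- s) weight R x)%:E.
  rewrite (integral_indic nu measurableT cyl_meas) setIT [in RHS](big_tnth _ _ s).
  exact: (nuE _ b).
have := u_nu f f_cont f_bounded; rewrite int_nu.
have empE N : (\int[empirical R u N]_x (f x)%:E)%E =
    (avg (fun t => (block u (t + 1) n == s)%:R) N)%:E.
  rewrite (integral_indic _ measurableT cyl_meas) setIT.
  rewrite /empirical /= /mscale /msum /= /avg EFinM; congr (_ * _)%E.
  rewrite -sumEFin; apply: eq_bigr => k _.
  transitivity ((shift_seq k.+1 u \in cyl)%:R%:E : \bar R); first exact: diracE.
  congr (_%:R%:E).
  congr (nat_of_bool _); rewrite addn1; apply/idP/eqP => [|kb].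
    rewrite inE => kb; apply: (@eq_from_nth _ trit0); rewrite size_block// => i lt_in.
    by rewrite nth_block// addnC [LHS](kb (Ordinal lt_in)) (tnth_nth trit0).
  rewrite inE => i; have := @nth_block _ u trit0 k.+1 n i (ltn_ord i).
  by rewrite kb (tnth_nth trit0) addnC.
under eq_cvg do rewrite empE.
move/fine_cvgP => [_ u1].
pose x t : R := (block u t n == s)%:R.
have x1 t : `|x t| <= 1 by rewrite /x; case: (_ == _); rewrite ?normr1 ?normr0.
exact/(cvg_avg_addn 1 _ x1).
Unshelve. all: by end_near.
Qed.

End GenericPoints.

Definition tritN1 : trit := SeqSub (isT : -1 \in ([:: -1; 0; 1] : seq int)).

Section Trits.
Variable R : realType.

Lemma trit_cases (P : trit -> Prop) :
  P tritN1 -> P trit0 -> P trit1 -> forall x, P x.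
Proof.
move=> Pm P0 P1 [x xP]; have := xP; rewrite !inE => /or3P[] /eqP xE; subst x.
- by rewrite (bool_irrelevance xP isT).
- by rewrite (bool_irrelevance xP trit0_subproof).
- by rewrite (bool_irrelevance xP trit1_subproof).
Qed.

Lemma sum_trit (F : trit -> R) :
  \sum_x F x = F tritN1 + F trit0 + F trit1.
Proof.
rewrite (bigD1 tritN1)//=.
rewrite (bigD1 trit0)//= (bigD1 trit1)//= big1 ?addr0 ?addrA//.
by elim/trit_cases.
Qed.

Lemma weight_gt0 x : 0 < weight R x.
Proof. by rewrite /weight; case: ifP. Qed.

Lemma weight_sum1 : \sum_x weight R x = 1.
Proof. by rewrite sum_trit /weight /=; field. Qed.

Lemma weight_mean0 : \sum_x weight R x * trit_val R x = 0.
Proof. by rewrite sum_trit /weight /trit_val /=; field. Qed.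

Lemma trit_valM x y : trit_val R (trit_mul x y) = trit_val R x * trit_val R y.
Proof. by rewrite /trit_val -intrM. Qed.

Lemma trit_val_bool b : trit_val R (trit_of_bool b) = b%:R.
Proof. by case: b. Qed.

Lemma trit_val_le1 x : `|trit_val R x| <= 1.
Proof. by move: x; elim/trit_cases; rewrite /trit_val /= ?normrN ?normr1 ?normr0. Qed.

Lemma prod_norm_le1 (I : finType) (F : I -> R) :
  (forall i, `|F i| <= 1) -> `|\prod_i F i| <= 1.
Proof. by move=> F1; rewrite normr_prod prodr_ile1// => i _; rewrite normr_ge0 F1. Qed.

End Trits.

Section ExpectMonomial.
Variables (R : realType) (A : finType) (p : A -> R).

(** Since the positions are distinct, [h j0] is the only factor at its letter; by independence its
    zero mean annihilates the product. *)
Lemma expect_monomial0 K r (pos : 'I_r -> nat) (h : 'I_r -> A -> R) x0 j0 :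
  (forall j, (pos j < K)%N) -> injective pos -> \sum_x p x * h j0 x = 0 ->
  expect p K (fun s => \prod_(j < r) h j (nth x0 s (pos j))) = 0.
Proof.
move=> ltK pos_inj h0.
pose phi i x := \prod_(j < r | pos j == i) h j x.
transitivity (expect p K (fun s => \prod_(i < K) phi i (nth x0 s i))).
  apply: eq_expect => s _.
  rewrite (partition_big (fun j => Ordinal (ltK j)) xpredT)//=.
  by apply: eq_bigr => i _; apply: eq_big => // j /eqP <-.
rewrite expect_prod (bigD1 (Ordinal (ltK j0)))//=.
rewrite (_ : \sum_x _ = 0) ?mul0r// -[RHS]h0; apply: eq_bigr => x _.
by rewrite /phi (big_pred1 j0)// => j; rewrite (inj_eq pos_inj).
Qed.

End ExpectMonomial.

Section Product.
Variables (R : realType) (eta : nat -> bool) (u : nat -> trit).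
Hypotheses (eta_low : forall n, (0 < n)%N -> (nblocks eta n <= n.+1)%N)
  (u_normal : normal (weight R) u).

Lemma condition_Ch_mul : condition_Ch R (bool_mul_seq eta u).
Proof.
move=> r a e a_gt0 a_incr e12 [j0 ej0].
have {ej0} ej0 : e j0 = 1%N by case: (e12 j0).
(* Position 0 is added for the factor z(n); positivity and strict growth of [a] keep the positions
   distinct. *)
pose pos (j : 'I_r.+1) := if unlift ord0 j is Some k then a k else 0%N.
have pos_lift k : pos (lift ord0 k) = a k by rewrite /pos liftK.
have pos0 : pos ord0 = 0%N by rewrite /pos unlift_none.
have a_inj : injective a.
  move=> j k ajk; apply/val_inj/eqP; case: (ltngtP j k) => // /a_incr; rewrite ajk ltnn//.
have pos_inj : injective pos.
  move=> j k; case: (unliftP ord0 j) => [j'|] ->; case: (unliftP ord0 k) => [k'|] ->//.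
  - by rewrite !pos_lift => /a_inj ->.
  - by rewrite pos_lift pos0 => aj; have := a_gt0 j'; rewrite aj.
  - by rewrite pos_lift pos0 => ak; have := a_gt0 k'; rewrite -ak.
pose K := (\max_j pos j).+1.
have ltK j : (pos j < K)%N by rewrite ltnS leq_bigmax.
pose f (s : seq bool) : R := \prod_j (nth false s (pos j))%:R ^+ e j.
pose g (s : seq trit) : R := \prod_j trit_val R (nth trit0 s (pos j)) ^+ e j.
have f1 s : `|f s| <= 1.
  apply: prod_norm_le1 => j; rewrite normrX exprn_ile1//.
  by case: nth; rewrite ?normr1 ?normr0.
have g1 s : `|g s| <= 1.
  by apply: prod_norm_le1 => j; rewrite normrX exprn_ile1// trit_val_le1.
have g0 : expect (weight R) K g = 0.
  apply: (@expect_monomial0 _ _ _ _ _ pos (fun j x => trit_val R x ^+ e j) trit0 j0) => //.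
  by rewrite ej0 -[RHS](weight_mean0 R).
have := decorrelation (fun x => ltW (weight_gt0 R x)) (weight_sum1 R)
  eta_low u_normal (ltn0Sn _) f1 g1 g0.
rewrite (_ : avg _ = avg (fun t => trit_val R (bool_mul_seq eta u t) ^+ e ord0 *
    \prod_(j < r) trit_val R (bool_mul_seq eta u (t + a j)%N) ^+ e (lift ord0 j)))//.
apply: eq_avg => t; rewrite /f /g -big_split/=.
have termE j : (nth false (block eta t K) (pos j))%:R ^+ e j *
    trit_val R (nth trit0 (block u t K) (pos j)) ^+ e j =
    trit_val R (bool_mul_seq eta u (t + pos j)) ^+ e j.
  by rewrite !nth_block// -exprMn -trit_val_bool -trit_valM.
under eq_bigr => j _ do rewrite termE.
rewrite big_ord_recl pos0 addn0; congr (_ * _).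
by apply: eq_bigr => j _; rewrite pos_lift.
Qed.

Hypothesis (delta : R) (eta_delta : bounds_num1 eta delta).

Lemma htop_mul : is_htop (bool_mul_seq eta u) (delta * log2 3).
Proof.
have op_false (x : trit) : trit_mul (trit_of_bool false) x = trit0.
  by move: x; elim/trit_cases; apply/val_inj.
have op_true (x : trit) : trit_mul (trit_of_bool true) x = x.
  by move: x; elim/trit_cases; apply/val_inj.
have := htop_fillings (weight_gt0 R) (weight_sum1 R) eta_low u_normal eta_delta
  (vals := enum {: trit}) (op := fun b x => trit_mul (trit_of_bool b) x)
  (enum_uniq _) _ op_false.
rewrite -cardT card_seq_sub//=; apply=> // x.
by rewrite op_true mem_enum.
Qed.

(** The square has the free letters 0 and 1, each equal to its own square, and [log2 2] is 1. *)
Lemma htop_sqr_mul : is_htop (sqr_seq (bool_mul_seq eta u)) delta.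
Proof.
pose op b (x : trit) := trit_mul (trit_mul (trit_of_bool b) x) (trit_mul (trit_of_bool b) x).
have op_false x : op false x = trit0.
  by move: x; elim/trit_cases; apply/val_inj.
have := htop_fillings (weight_gt0 R) (weight_sum1 R) eta_low u_normal eta_delta
  (vals := [:: trit0; trit1]) (op := op) _ _ op_false.
rewrite /= /log2 divff ?mulr1; last by rewrite gt_eqF// ln_gt0// ltr1n.
apply=> // x; rewrite !inE.
  by move: x; elim/trit_cases; rewrite -!val_eqE.
by move=> /orP[] /eqP ->; apply/val_inj.
Qed.

End Product.

(** * Existence of normal sequences *)

Section Greedy.
Variables (R : realType) (A : finType) (p : A -> R).
Hypotheses (p_ge0 : forall x, 0 <= p x) (p_sum1 : \sum_x p x = 1).
Implicit Types h : seq A.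

(* Histories are stored in reverse, the latest symbol first.  The test of index i
   codes a word s and a symbol d; it is active from time i on, so that
   [potential] is a finite sum. *)
Definition increment (i : nat) h (c : A) : R :=
  if unpickle i is Some (s, d) then
    if (i <= size h)%N && (take (size s) h == rev s)
    then (c == d)%:R - p d else 0
  else 0.

Fixpoint discrepancy (i : nat) h : R :=
  if h is c :: h' then discrepancy i h' + increment i h' c else 0.

Definition potential h : R :=
  \sum_(i < size h) 2 ^- i.+1 * discrepancy i h ^+ 2.

Lemma p_le1 x : p x <= 1.
Proof. by rewrite -p_sum1 (bigD1 x)//= lerDl sumr_ge0. Qed.

Lemma increment_le1 i h c : `|increment i h c| <= 1.
Proof.
rewrite /increment; case: unpickle => [[s d]|]; last by rewrite normr0.
case: ifP; last by rewrite normr0.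
have := p_ge0 d; have := p_le1 d; rewrite ler_norml.
by case: (c == d) => /= *; lra.
Qed.

Lemma increment_mean0 i h : \sum_c p c * increment i h c = 0.
Proof.
rewrite /increment; case: unpickle => [[s d]|]; last by rewrite big1// => c; rewrite mulr0.
case: (_ && _); last by rewrite big1// => c; rewrite mulr0.
under eq_bigr => c _ do rewrite mulrBr.
rewrite sumrB -mulr_suml p_sum1 mul1r (bigD1 d)//= eqxx mulr1 big1 ?addr0 ?subrr//.
by move=> c /negPf ->; rewrite mulr0.
Qed.

Lemma discrepancy0 i h : (size h <= i)%N -> discrepancy i h = 0.
Proof.
elim: h => [//|c h IHh] /= lt_hi; rewrite IHh ?add0r; last exact: ltnW.
by rewrite /increment; case: unpickle => [[s d]|//]; rewrite leqNgt lt_hi.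
Qed.

Lemma sum_exp2V n : \sum_(i < n) 2 ^- i.+1 <= 1 :> R.
Proof.
have -> : \sum_(i < n) 2 ^- i.+1 = 1 - 2 ^- n :> R.
  elim: n => [|n IHn]; first by rewrite big_ord0 expr0 invr1 subrr.
  rewrite big_ord_recr IHn /= exprS invfM; lra.
by rewrite gerBl invr_ge0 exprn_ge0.
Qed.

(** If every value exceeded the mean, all weights would vanish. *)
Lemma exists_le_mean (F : A -> R) : exists c, F c <= \sum_x p x * F x.
Proof.
apply: contrapT => /forallNP noF; set m := \sum_x _ in noF.
have F_gt c : m < F c by rewrite ltNge; apply/negP.
have sum0 : \sum_c p c * (F c - m) = 0.
  under eq_bigr => c _ do rewrite mulrBr.
  by rewrite sumrB -mulr_suml p_sum1 mul1r subrr.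
have term_ge0 c : 0 <= p c * (F c - m) by rewrite mulr_ge0// subr_ge0 ltW.
have p0 c : p c = 0.
  have /eqP := psumr_eq0P (fun c _ => term_ge0 c) sum0 (i := c) isT.
  by rewrite mulf_eq0 subr_eq0 [F c == m]gt_eqF// orbF => /eqP.
by move: p_sum1; rewrite big1// => /eqP; rewrite eq_sym oner_eq0.
Qed.

(** When the squares are expanded, the cross terms have mean 0 and the squared increments contribute
    at most the sum of the weights 2^-(i+1). *)
Lemma exists_potential_step h : exists c, potential (c :: h) <= potential h + 1.
Proof.
have [c0 /le_trans le_c0] := exists_le_mean (fun c => potential (c :: h)).
exists c0; apply: le_c0.
have -> : \sum_c p c * potential (c :: h) =
    \sum_(i < (size h).+1) 2 ^- i.+1 * (discrepancy i h ^+ 2 +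
      \sum_c p c * increment i h c ^+ 2).
  have potE c : potential (c :: h) = \sum_(i < (size h).+1)
      2 ^- i.+1 * (discrepancy i h + increment i h c) ^+ 2 by [].
  under eq_bigr => c _ do rewrite potE mulr_sumr.
  rewrite exchange_big; apply: eq_bigr => i _.
  transitivity (2 ^- i.+1 * \sum_c (discrepancy i h ^+ 2 * p c +
      2 * discrepancy i h * (p c * increment i h c) + p c * increment i h c ^+ 2)).
    by rewrite mulr_sumr; apply: eq_bigr => c _ /=; ring.
  by rewrite !big_split /= -!mulr_sumr p_sum1 increment_mean0 mulr1 mulr0 addr0.
under eq_bigr => i _ do rewrite mulrDr.
rewrite big_split /= lerD//.
  (* The one index that is not in [potential h] belongs to a test whose discrepancy is still 0. *)
  by rewrite big_ord_recr /= discrepancy0// expr0n mulr0 addr0.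
apply: le_trans (sum_exp2V (size h).+1); apply: ler_sum => i _.
rewrite ler_piMr ?invr_ge0 ?exprn_ge0// -p_sum1; apply: ler_sum => c _.
rewrite ler_piMr//; apply: norm_le1_sqr; exact: increment_le1.
Qed.

Lemma exists_normal : exists u, normal p u.
Proof.
have [next nextP] := choice exists_potential_step.
pose hist n := iter n (fun h => next h :: h) [::].
pose u n := next (hist n); exists u.
have size_hist n : size (hist n) = n by elim: n => //= n ->.
have histD t m : hist (t + m)%N = rev (block u t m) ++ hist t.
  elim: m => [|m IHm]; first by rewrite addn0.
  by rewrite addnS block_rcons rev_rcons cat_cons -IHm.
have potential_le n : potential (hist n) <= n%:R.
  elim: n => [|n IHn]; first by rewrite /potential big_ord0.
  by rewrite -natr1 (le_trans (nextP _))// lerD2r.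
pose x i t := increment i (hist t) (u t).
have x1 i t : `|x i t| <= 1 by exact: increment_le1.
have discrepancyE i n : discrepancy i (hist n) = \sum_(t < n) x i t.
  by elim: n => [|n IHn]; rewrite ?big_ord0// big_ord_recr -IHn.
have avg_x i : avg (x i) @ \oo --> 0.
  apply/cvgr0Pnorm_le => e e0.
  (* A single term of the potential is at most N, so the squared discrepancy is at most 2^(i+1) N
     and the squared average at most 2^(i+1)/N. *)
  have : \forall N \near \oo, `|2 ^+ i.+1 / N%:R : R| <= e ^+ 2.
    by move/cvgr0Pnorm_le: (cvg_divn (2 ^+ i.+1 : R)); apply; rewrite exprn_gt0.
  apply: filterS2 (nbhs_infty_gt i) => N ltiN.
  have N0 : 0 < N%:R :> R by rewrite ltr0n (leq_ltn_trans _ ltiN).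
  rewrite ger0_norm ?divr_ge0 ?exprn_ge0// => le_e.
  rewrite -(ler_pXn2r (n := 2))// ?nnegrE ?(ltW e0)// real_normK ?num_real//.
  apply: le_trans le_e; rewrite /avg -discrepancyE exprMn exprVn.
  have : 2 ^- i.+1 * discrepancy i (hist N) ^+ 2 <= N%:R.
    apply: le_trans (potential_le N).
    rewrite /potential size_hist (bigD1 (Ordinal ltiN))//= lerDl sumr_ge0// => j _.
    by rewrite mulr_ge0 ?sqr_ge0// invr_ge0 exprn_ge0.
  rewrite ler_pdivrMl ?exprn_gt0// => le_N.
  rewrite ler_pdivrMl ?exprn_gt0//; apply: le_trans le_N _.
  rewrite le_eqVlt; apply/orP; left; apply/eqP; field; rewrite gt_eqF//.
(* The frequency of [rcons s d] is [p d] times that of [s], up to the average of the test coding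
   [(s, d)]. *)
elim/last_ind => [|s d IHs].
  by rewrite big_nil; under eq_avg => t do rewrite eqxx; exact: cvg_avg_cst.
rewrite -cats1 big_cat big_seq1 /= mulrC -[X in _ --> X]add0r cats1.
pose y t : R := (block u t (size s) == s)%:R * ((u (t + size s)%N == d)%:R - p d).
have y1 t : `|y t| <= 1.
  rewrite normrM mulr_ile1//; first by case: (_ == s); rewrite ?normr1 ?normr0.
  have := p_ge0 d; have := p_le1 d; rewrite ler_norml.
  by case: (_ == d) => /= *; lra.
have avg_y : avg y @ \oo --> 0.
  pose i := pickle (s, d).
  (* At time t + i + size s the test is active and reads the window starting at t + i. *)
  apply/(cvg_avg_addn i _ y1).
  have /(cvg_avg_addn (i + size s) _ (x1 i)) := avg_x i.
  rewrite (_ : avg _ = avg (fun t => y (t + i)%N))//.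
  apply: eq_avg => t; rewrite /x /increment pickleK size_hist addnA.
  rewrite -addnA [(i <= _)%N](_ : _ = true); last by lia.
  rewrite addnA histD take_size_cat ?size_rev ?size_block//=.
  by rewrite /y (inj_eq (can_inj revK)); case: (_ == s); rewrite ?mul1r ?mul0r.
have := cvg_avgD avg_y (cvg_avgZ (a := p d) IHs).
rewrite (_ : avg _ = avg (fun t => (block u t (size (rcons s d)) == rcons s d)%:R))//.
apply: eq_avg => t; rewrite /y size_rcons block_rcons eqseq_rcons.
by case: (_ == s); case: (_ == d); rewrite /=; ring.
Qed.

End Greedy.

(** * Mechanical words *)

Section Mechanical.
Variables (R : realType) (delta : R).
Hypothesis delta01 : 0 <= delta <= 1.

Let cut (n : nat) : nat := Num.truncn (delta * n%:R).

(** The integer part of delta n grows by 0 or 1 at each step; the letter records whether it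
    grows. *)
Definition mechanical (n : nat) : bool := cut n.+1 != cut n.

Let cutP n : (cut n)%:R <= delta * n%:R < (cut n).+1%:R.
Proof. by apply: truncn_itv; rewrite mulr_ge0//; case/andP: delta01. Qed.

Let le_cut m n : m%:R <= delta * n%:R -> (m <= cut n)%N.
Proof.
move=> le_m; rewrite -ltnS -(ltr_nat R).
by have /andP[_] := cutP n; apply: le_lt_trans.
Qed.

Let cut_le m n : delta * n%:R < m.+1%:R -> (cut n <= m)%N.
Proof.
move=> lt_m; rewrite -ltnS -(ltr_nat R).
by have /andP[+ _] := cutP n; move=> /le_lt_trans; apply.
Qed.

Let cutD t i : (cut t + cut i <= cut (t + i) <= cut t + cut i + 1)%N.
Proof.
have /andP[t1 t2] := cutP t; have /andP[i1 i2] := cutP i.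
apply/andP; split; first by apply: le_cut; rewrite !natrD; lra.
apply: cut_le; move: t2 i2; rewrite -!natr1 !natrD; lra.
Qed.

Let cut0 : cut 0 = 0%N.
Proof. by rewrite /cut mulr0 truncn0. Qed.

Let cutS n : (cut n <= cut n.+1 <= (cut n).+1)%N.
Proof.
have := cutP n; have := cutP n.+1.
move=> /andP[t1 t2] /andP[i1 i2]; case/andP: delta01 => d0 d1.
apply/andP; split; first by apply: le_cut; rewrite -natr1; lra.
by apply: cut_le; move: i2; rewrite -!natr1; lra.
Qed.

Let count_cut t n : (count_mem true (block mechanical t n) + cut t = cut (t + n))%N.
Proof.
elim: n => [|n IHn]; first by rewrite addn0.
rewrite block_rcons -cats1 count_cat /= addn0 addnAC IHn addnS /mechanical.
by have := cutS (t + n); case: eqP => /=; lia.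
Qed.

(** By telescoping, a block of length n has [cut n] or [cut n + 1] ones, within 1 of delta n. *)
Lemma mechanical_num1 : bounds_num1 mechanical delta.
Proof.
exists 0%N => // n _ b /(appearsP mechanical b) [t tb].
have /andP[n1 n2] := cutP n; rewrite -natr1 in n2.
have /andP[] : (cut n <= num1 b <= (cut n).+1)%N.
  by rewrite /num1 -tb; have := count_cut t n; have := cutD t n; lia.
by rewrite -!(ler_nat R) -[(cut n).+1%:R]natr1; lra.
Qed.

(* The excess is 0 or 1, and as a function of i it increases with the fractional
   part of delta * t, so it is determined by its sum. *)
Let excess (t i : nat) : nat := (cut (t + i) - (cut t + cut i))%N.

Let excess_comparable t t' :
  (forall i, excess t i <= excess t' i)%N \/ (forall i, excess t' i <= excess t i)%N.
Proof.
wlog le_frac : t t' / delta * t%:R - (cut t)%:R <= delta * t'%:R - (cut t')%:R.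
  move=> H; have [/H//|/ltW/H] := leP (delta * t%:R - (cut t)%:R)
    (delta * t'%:R - (cut t')%:R).
  by case; [right|left].
left=> i; have /andP[ti _] := cutP (t + i); have cutDti := cutD t i.
suff : (cut (t + i) + cut t' - cut t <= cut (t' + i))%N.
  by rewrite /excess; have := cutD t' i; lia.
apply: le_cut; rewrite natrB; last by lia.
by move: ti; rewrite !natrD; lra.
Qed.

(** The sum [sigma] of the excesses takes at most n + 1 values and determines the block. Only an
    inequality holds in general, as the word is periodic for rational delta. *)
Lemma mechanical_nblocks n : (nblocks mechanical n <= n.+1)%N.
Proof.
pose sigma t := (\sum_(i < n) excess t i.+1)%N.
have sigma_le t : (sigma t < n.+1)%N.
  rewrite ltnS -[leqRHS]card_ord -sum1_card leq_sum// => i _.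
  by rewrite /excess; have := cutD t i.+1; lia.
have sigma_excess t t' : (forall i, excess t i <= excess t' i)%N -> sigma t = sigma t' ->
    forall i, (i < n)%N -> excess t i.+1 = excess t' i.+1.
  move=> le_tt' sigmaE i lt_in.
  have /eqP : (\sum_(j < n) (excess t' j.+1 - excess t j.+1) = 0)%N.
    by rewrite sumnB// -/(sigma t) -/(sigma t') sigmaE subnn.
  rewrite sum_nat_eq0 => /forallP/(_ (Ordinal lt_in))/=.
  by have := le_tt' i.+1; lia.
have sigma_block t t' : sigma t = sigma t' -> block mechanical t n = block mechanical t' n.
  move=> sigmaE; have excessE i : (i <= n)%N -> excess t i = excess t' i.
    case: i => [|i] lt_in; first by rewrite /excess cut0 !addn0 !subnn.
    by have [/sigma_excess|/sigma_excess H] := excess_comparable t t';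
      [apply | rewrite (H (esym sigmaE))].
  apply: (@eq_from_nth _ false); rewrite !size_block// => i lt_in.
  (* Letter i depends on the growth of [cut] from t + i to t + i + 1, which is its growth from i to
     i + 1 plus the change of the excess. *)
  rewrite !nth_block// /mechanical -!addnS.
  have := excessE i (ltnW lt_in); have := excessE i.+1 lt_in; rewrite /excess.
  have := cutD t i; have := cutD t' i; have := cutD t i.+1; have := cutD t' i.+1.
  by move=> *; apply/idP/idP; lia.
have [rep repP] : exists rep : nat -> seq bool,
    forall t, block mechanical t n = rep (sigma t).
  have /choice[rep repP] : forall v, exists s,
      forall t, sigma t = v -> block mechanical t n = s.
    move=> v; have [[t0 tv]|no_t] := pselect (exists t, sigma t = v).
      by exists (block mechanical t0 n) => t; rewrite -tv => /sigma_block.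
    by exists [::] => t tv; case: no_t; exists t.
  by exists rep => t; exact: repP.
rewrite -[leqRHS](size_iota 0) -(size_map rep); apply: nblocks_le => t.
by rewrite repP map_f// mem_iota sigma_le.
Qed.

End Mechanical.

Theorem proposition6p12 (R : realType) :
  (forall (eta : nat -> bool) (u : trit_seq)
      (nu : probability (borel trit_seq) R) (delta : R),
    sturmian eta ->
    is_product_measure (weight R) nu ->
    generic u nu ->
    0 <= delta <= 1 ->
    bounds_num1 eta delta ->
    let z := bool_mul_seq eta u in
    [/\ condition_Ch R z,
        is_htop (sqr_seq z) delta
      & is_htop z (delta * log2 3)])
  /\
  (forall delta : R, 0 <= delta <= 1 ->
    exists z : nat -> trit,
      [/\ condition_Ch R z,
          is_htop (sqr_seq z) delta
        & is_htop z (delta * log2 3)]).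
Proof.
split=> [eta u nu delta eta_sturmian nuE u_generic _ eta_delta z | delta delta01].
  have eta_low n : (0 < n)%N -> (nblocks eta n <= n.+1)%N by move/eta_sturmian ->.
  have u_normal := generic_normal nuE u_generic.
  split; first exact: condition_Ch_mul.
    exact: htop_sqr_mul eta_delta.
  exact: htop_mul eta_delta.
(* No Sturmian word has rational slope, so every delta is treated through the complexity bound of
   the mechanical word. *)
have [u u_normal] := exists_normal (fun x => ltW (weight_gt0 R x)) (weight_sum1 R).
have eta_low n (_ : (0 < n)%N) := mechanical_nblocks delta01 n.
have eta_delta := mechanical_num1 delta01.
exists (bool_mul_seq (mechanical delta) u).
split; first exact: condition_Ch_mul.
  exact: htop_sqr_mul eta_delta.
exact: htop_mul eta_delta.
Qed.
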